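(* Assume the setting, the problems and the algorithm described in the context, and suppose: (A.1) $\varphi_1$ is $L$-smooth and $\sigma$-hypoconvex with $\sigma\in[-L,L]$; (A.2) $\varphi_2$ is lower semicontinuous and proper; (A.3) the problem $\min_{u}\varphi_1(u)+\varphi_2(u)$ has a solution; (B.1) the constants in the acceptance condition satisfy $\nu_1>0$, $\nu_2\ge 0$; (B.2) $\varphi_1+\varphi_2$ is level-bounded; (B.3) $\gamma=1/\beta$ satisfies $\gamma<\min\{\frac{1}{2\max\{-\sigma,0\}},\frac1L\}$ (with $1/0=+\infty$). Let $\{(s_k,u_k,v_k)\}$ be the sequence generated by the algorithm with the acceptance condition based on the DR envelope $\psi_E$. Then: (a) $\{\psi_E(s_k)\}$ is monotonically decreasing (in the non-strict sense) and $\|v_k-u_k\|\to 0$. (b) The sequence $\{(s_k,u_k,v_k)\}$ is bounded. If any subsequence $\{s_{k_i}\}$ converges to a point $s^*$, then $s^*$ is a fixed point of $\mathcal G$ (i.e. $s^*\in\mathcal G(s^* )$) and $u^*=\mathrm{prox}_{\gamma\varphi_1}(s^* )$ is a stationary point of $\min_u\varphi_1(u)+\varphi_2(u)$, i.e. $0\in\partial\varphi_1(u^* )+\partial\varphi_2(u^* )$. Moreover, such a convergent subsequence must exist. (c) Suppose in addition that (B.4) holds: for every given $s\in\mathbb R^p$ the function $z\mapsto g(z)+\frac\beta2\|Bz+c-s\|^2$ is level-bounded and bounded from below. For any convergent subsequence $\{s_{k_i}\}$ as in (b) with limit $s^*$ and $u^*=\mathrm{prox}_{\gamma\varphi_1}(s^*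 )$, let $\{z_{k_i}\}$ be the corresponding subsequence generated by the algorithm, so $z_{k_i}\in\operatorname{argmin}_z\big(g(z)+\frac1{2\gamma}\|Bz+c-(2u_{k_i}-s_{k_i})\|^2\big)$. Then $\{z_{k_i}\}$ is bounded. Let $z^*$ be a cluster point of $\{z_{k_i}\}$, let $x^*\in\operatorname{argmin}_x f(x)+\frac\beta2\|Ax-s^*\|^2$ and $y^*=u^*-s^*$. Then $(x^*,y^*,z^* )$ is a stationary point of the problem $\min_{x,z} f(x)+g(z)$ s.t. $Ax-Bz=c$.
   Context: Setting: $f:\mathbb R^n\to\mathbb R\cup\{+\infty\}$ and $g:\mathbb R^q\to\mathbb R\cup\{+\infty\}$ are proper and lower semicontinuous, $A\in\mathbb R^{p\times n}$, $B\in\mathbb R^{p\times q}$, $c\in\mathbb R^p$, $\beta>0$, $\gamma=1/\beta$. The problem is $\min_{x,z}f(x)+g(z)$ s.t. $Ax-Bz=c$. Standing assumption: for every $s\in\mathbb R^p$ the sets $X_\beta(s)=\operatorname{argmin}_x\{f(x)+\frac\beta2\|Ax-s\|^2\}$ and $Z_\beta(s)=\operatorname{argmin}_z\{g(z)+\frac\beta2\|Bz+c-s\|^2\}$ are nonempty. Image functions: for $h:\mathbb R^n\to\mathbb R\cup\{+\infty\}$ and a matrix $C\in\mathbb R^{p\times n}$, $h_C(u)=\inf\{h(y): Cy=u\}$ if $u$ is in the range of $C$, and $h_C(u)=+\infty$ otherwise. Put $\varphi_1(u)=f_A(u)$ and $\varphi_2(u)=g_B(u-c)$ on $\mathbb R^p$.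 $\mathrm{prox}_{\gamma\varphi}(s)=\operatorname{argmin}_{w}\{\varphi(w)+\frac1{2\gamma}\|w-s\|^2\}$ (possibly set-valued). The set-valued map $\mathcal G$ is $\mathcal G(s)=\{s+v-u:\ u\in\mathrm{prox}_{\gamma\varphi_1}(s),\ v\in\mathrm{prox}_{\gamma\varphi_2}(2u-s)\}$. DR envelope: $\psi_E(s)=\min_w\big(\varphi_1(u(s))+\varphi_2(w)+\langle\nabla\varphi_1(u(s)),w-u(s)\rangle+\frac1{2\gamma}\|w-u(s)\|^2\big)$ with $u(s)=\mathrm{prox}_{\gamma\varphi_1}(s)$. Definitions: $F$ is $L$-smooth if it is differentiable and $\|\nabla F(x)-\nabla F(y)\|\le L\|x-y\|$ for all $x,y$; $\sigma$-hypoconvex if it is differentiable and $\langle\nabla F(x)-\nabla F(y),x-y\rangle\ge\sigma\|x-y\|^2$ for all $x,y$; level-bounded if $\{x:F(x)\le\alpha\}$ is bounded for every $\alpha\in\mathbb R$. $\partial$ denotes the generalized (limiting) subdifferential of Rockafellar–Wets, Definition 8.3. A triple $(x^*,y^*,z^* )$ is a stationary point of $\min f(x)+g(z)$ s.t. $Ax-Bz=c$ if $Ax^*-Bz^*=c$, $-\beta A^Ty^*\in\partial f(x^* )$ and $\beta B^Ty^*\in\partial g(z^* )$. Algorithm (Anderson-accelerated DR splitting, run without termination test): given an integer $m\in\mathbb N$, constants $\nu_1,\nu_2$, and $s_0=Ax_0-y_0$ for given initial $x_0,y_0$. For $k=0,1,2,\dots$: choose $x_k\in X_\beta(s_k)$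 and set $u_k=Ax_k$; choose $z_k\in Z_\beta(2u_k-s_k)$ and set $v_k=Bz_k+c$ (so $u_k\in\mathrm{prox}_{\gamma\varphi_1}(s_k)$, $v_k\in\mathrm{prox}_{\gamma\varphi_2}(2u_k-s_k)$); set $t_k=s_k+v_k-u_k$, $r_k=t_k-s_k$, $\bar m=\min(m,k)$; let $(\theta_1^*,\dots,\theta_{\bar m}^* )$ minimize $\|r_k-\sum_{j=1}^{\bar m}\theta_j(r_{k-j+1}-r_{k-j})\|^2$ and set $s_{AA}=t_k-\sum_{j=1}^{\bar m}\theta_j^*(t_{k-j+1}-t_{k-j})$. Acceptance condition: if $\psi_E(s_{AA})-\psi_E(s_k)\le-\nu_1\|t_k-s_k\|^2-\nu_2\|s_{AA}-s_k\|^2$, then $s_{k+1}=s_{AA}$; otherwise $s_{k+1}=t_k$ (the unaccelerated iterate). *)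

(* Defs.v *)
From HB Require Import structures.
From mathcomp Require Import all_boot all_order all_algebra.
From mathcomp Require Import all_classical all_reals all_analysis.

Set Implicit Arguments.
Unset Strict Implicit.
Unset Printing Implicit Defensive.

Import Order.TTheory GRing.Theory Num.Theory.
Import numFieldNormedType.Exports.

Local Open Scope classical_set_scope.
Local Open Scope ring_scope.

(* The norm `|x| of the library on 'cV[R]_n is the max norm, so the Euclidean
   structure is introduced here.  Limits, differentiability and boundedness are
   those of the library: they are the same for all norms on R^n. *)
Definition dotp {R : realType} {n : nat} (x y : 'cV[R]_n) : R :=
  \sum_(i < n) x i 0 * y i 0.

Definition enorm {R : realType} {n : nat} (x : 'cV[R]_n) : R :=
  Num.sqrt (dotp x x).

(* Functions R^n -> R u {+oo} are maps into \bar R that avoid -oo, which is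
   part of being proper. *)
Definition proper_fun {R : realType} {T : Type} (F : T -> \bar R) : Prop :=
  (forall x, (-oo < F x)%E) /\ (exists x, (F x < +oo)%E).

(* Empty when F is identically +oo, as in Rockafellar-Wets. *)
Definition argmin {R : realType} {T : Type} (F : T -> \bar R) : set T :=
  [set x | (F x < +oo)%E /\ forall y, (F x <= F y)%E].

Definition level_bounded {R : realType} {n : nat} (F : 'cV[R]_n -> \bar R) :
    Prop :=
  forall alpha : R, bounded_set [set x | (F x <= alpha%:E)%E].

Definition bounded_below {R : realType} {T : Type} (F : T -> \bar R) : Prop :=
  exists M : R, forall x, (M%:E <= F x)%E.

Definition differentiable_fun {R : realType} {n : nat}
    (F : 'cV[R]_n -> \bar R) : Prop :=
  (forall x, F x \is a fin_num) /\
  (forall x, differentiable (fine \o F) x).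

(* Vector of partial derivatives; meaningful for a differentiable F. *)
Definition grad {R : realType} {n : nat} (F : 'cV[R]_n -> \bar R)
    (x : 'cV[R]_n) : 'cV[R]_n :=
  \col_i 'D_(delta_mx i 0) (fine \o F) x.

Definition L_smooth {R : realType} {n : nat} (L : R) (F : 'cV[R]_n -> \bar R) :
    Prop :=
  differentiable_fun F /\
  forall x y, enorm (grad F x - grad F y) <= L * enorm (x - y).

Definition hypoconvex {R : realType} {n : nat} (sigma : R)
    (F : 'cV[R]_n -> \bar R) : Prop :=
  differentiable_fun F /\
  forall x y, sigma * enorm (x - y) ^+ 2 <= dotp (grad F x - grad F y) (x - y).

(* Regular (Frechet) subgradients, Rockafellar-Wets 8.3(a):
   F y >= F x + <v, y - x> + o(|y - x|), with F finite at x. *)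
Definition regular_subdiff {R : realType} {n : nat} (F : 'cV[R]_n -> \bar R)
    (x : 'cV[R]_n) : set 'cV[R]_n :=
  [set v | F x \is a fin_num /\
    forall e : R, 0 < e ->
      \forall y \near x,
        (F x + (dotp v (y - x) - e * enorm (y - x))%:E <= F y)%E].

(* General (limiting) subgradients, Rockafellar-Wets 8.3(b). *)
Definition subdiff {R : realType} {n : nat} (F : 'cV[R]_n -> \bar R)
    (x : 'cV[R]_n) : set 'cV[R]_n :=
  [set v | F x \is a fin_num /\
    exists (xs vs : nat -> 'cV[R]_n),
      [/\ xs @ \oo --> x,
          (F \o xs) @ \oo --> F x,
          forall i, regular_subdiff F (xs i) (vs i)
        & vs @ \oo --> v]].

(* The infimum over the empty set is +oo, so h_C(u) = +oo when u is not in the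
   range of C. *)
Definition image_fun {R : realType} {p n : nat} (C : 'M[R]_(p, n))
    (h : 'cV[R]_n -> \bar R) (u : 'cV[R]_p) : \bar R :=
  ereal_inf [set h y | y in [set y | C *m y = u]].

Definition prox {R : realType} {p : nat} (gamma : R) (phi : 'cV[R]_p -> \bar R)
    (s : 'cV[R]_p) : set 'cV[R]_p :=
  argmin (fun w => (phi w + ((2 * gamma)^-1 * enorm (w - s) ^+ 2)%:E)%E).

Definition X_sub {R : realType} {p n : nat} (beta : R)
    (f : 'cV[R]_n -> \bar R) (A : 'M[R]_(p, n)) (s : 'cV[R]_p) :
    set 'cV[R]_n :=
  argmin (fun x => (f x + (beta / 2 * enorm (A *m x - s) ^+ 2)%:E)%E).

Definition Z_obj {R : realType} {p q : nat} (beta : R)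
    (g : 'cV[R]_q -> \bar R) (B : 'M[R]_(p, q)) (c s : 'cV[R]_p)
    (z : 'cV[R]_q) : \bar R :=
  (g z + (beta / 2 * enorm (B *m z + c - s) ^+ 2)%:E)%E.

Definition Z_sub {R : realType} {p q : nat} (beta : R)
    (g : 'cV[R]_q -> \bar R) (B : 'M[R]_(p, q)) (c s : 'cV[R]_p) :
    set 'cV[R]_q :=
  argmin (Z_obj beta g B c s).

Definition DR_map {R : realType} {p : nat} (gamma : R)
    (phi1 phi2 : 'cV[R]_p -> \bar R) (s : 'cV[R]_p) : set 'cV[R]_p :=
  [set t | exists u v,
    [/\ prox gamma phi1 s u, prox gamma phi2 (2 *: u - s) v & t = s + v - u]].

(* u(s) is a chosen element of the prox; it is the only one as soon as
   gamma < 1 / max(-sigma, 0) with phi1 sigma-hypoconvex. *)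
Definition DR_envelope {R : realType} {p : nat} (gamma : R)
    (phi1 phi2 : 'cV[R]_p -> \bar R) (s : 'cV[R]_p) : \bar R :=
  let u := xget 0 (prox gamma phi1 s) in
  ereal_inf (range (fun w =>
    (phi1 u + phi2 w
     + (dotp (grad phi1 u) (w - u)
        + (2 * gamma)^-1 * enorm (w - u) ^+ 2)%:E)%E)).

Definition stationary_point {R : realType} {n q p : nat}
    (f : 'cV[R]_n -> \bar R) (g : 'cV[R]_q -> \bar R) (A : 'M[R]_(p, n))
    (B : 'M[R]_(p, q)) (c : 'cV[R]_p) (beta : R)
    (x : 'cV[R]_n) (y : 'cV[R]_p) (z : 'cV[R]_q) : Prop :=
  [/\ A *m x - B *m z = c,
      subdiff f x (- beta *: (A^T *m y))
    & subdiff g z (beta *: (B^T *m y))].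

(* 0 in dF(x) + dG(x) *)
Definition stationary_sum {R : realType} {p : nat}
    (F G : 'cV[R]_p -> \bar R) (x : 'cV[R]_p) : Prop :=
  exists a b, [/\ subdiff F x a, subdiff G x b & a + b = 0].

Section Iteration.
Context {R : realType} {p : nat}.
Implicit Types (s u v : nat -> 'cV[R]_p) (m k : nat).

Definition DR_step s u v k : 'cV[R]_p := s k + v k - u k.

Definition DR_residual s u v k : 'cV[R]_p := DR_step s u v k - s k.

(* Only the values eta 1, ..., eta (minn m k) are used. *)
Definition AA_objective m s u v k (eta : nat -> R) : R :=
  enorm (DR_residual s u v k
         - \sum_(1 <= j < (minn m k).+1)
             eta j *: (DR_residual s u v (k - j).+1
                       - DR_residual s u v (k - j))) ^+ 2.

Definition AA_candidate m s u v k (eta : nat -> R) : 'cV[R]_p :=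
  DR_step s u v k
  - \sum_(1 <= j < (minn m k).+1)
      eta j *: (DR_step s u v (k - j).+1 - DR_step s u v (k - j)).

Definition AA_accept (gamma nu1 nu2 : R) (phi1 phi2 : 'cV[R]_p -> \bar R)
    (sk tk saa : 'cV[R]_p) : Prop :=
  (DR_envelope gamma phi1 phi2 saa - DR_envelope gamma phi1 phi2 sk
   <= (- nu1 * enorm (tk - sk) ^+ 2 - nu2 * enorm (saa - sk) ^+ 2)%:E)%E.

End Iteration.

(* The initial point xinit only serves to define s 0; the iterate x 0 is then
   chosen in X_beta(s 0) like all the others. *)
Record AADR_run {R : realType} {n q p : nat}
    (f : 'cV[R]_n -> \bar R) (g : 'cV[R]_q -> \bar R)
    (A : 'M[R]_(p, n)) (B : 'M[R]_(p, q)) (c : 'cV[R]_p)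
    (beta gamma : R) (phi1 phi2 : 'cV[R]_p -> \bar R)
    (m : nat) (nu1 nu2 : R)
    (xinit : 'cV[R]_n) (yinit : 'cV[R]_p)
    (x : nat -> 'cV[R]_n) (z : nat -> 'cV[R]_q)
    (s u v : nat -> 'cV[R]_p) (theta : nat -> nat -> R) : Prop := {
  run_init : s 0%N = A *m xinit - yinit;
  run_x : forall k, X_sub beta f A (s k) (x k);
  run_u : forall k, u k = A *m x k;
  run_z : forall k, Z_sub beta g B c (2 *: u k - s k) (z k);
  run_v : forall k, v k = B *m z k + c;
  run_theta : forall k (eta : nat -> R),
    AA_objective m s u v k (theta k) <= AA_objective m s u v k eta;
  run_accept : forall k,
    AA_accept gamma nu1 nu2 phi1 phi2 (s k) (DR_step s u v k)
      (AA_candidate m s u v k (theta k)) ->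
    s k.+1 = AA_candidate m s u v k (theta k);
  run_reject : forall k,
    ~ AA_accept gamma nu1 nu2 phi1 phi2 (s k) (DR_step s u v k)
        (AA_candidate m s u v k (theta k)) ->
    s k.+1 = DR_step s u v k
}.

(* Main.v *)
(* On the reduced problem min phi1 + phi2, a step s+ = s + v - u with
   d = u+ - u and e = grad phi1 u+ - grad phi1 u changes the DR envelope by at
   most gamma |e|^2 - |d|^2 / (2 gamma) - D(u, u+), where D is the Bregman
   distance of phi1.  Cocoercivity bounds D(u, u+) below by
   (a l |d|^2 + |e|^2) / (2 (l + a)) with a = min(sigma, 0) and any smoothness
   modulus l >= L; taking l = 1 / gamma > L and |e| <= L |d| leaves a negative
   multiple of |d|^2, hence of |v - u|^2.  Accepted Anderson steps decrease the
   envelope by nu1 |v - u|^2, so in all cases the envelope decreases by a multiple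
   of |v_k - u_k|^2; it is bounded below by min (phi1 + phi2) and dominates
   (phi1 + phi2)(v_k), which gives (a) and boundedness.  The limits in (b) and (c)
   follow because minimizers of F + b |C x - a|^2, for F lower semicontinuous,
   depend on a with closed graph and -2 b C^T (C x - a) is a subgradient of F at
   such a minimizer; f, g, phi1 and phi2 are all instances. *)

Require Import Defs.
From HB Require Import structures.
From mathcomp Require Import all_boot all_order all_algebra.
From mathcomp Require Import all_classical all_reals all_analysis.
From mathcomp Require Import ring lra.

Set Implicit Arguments.
Unset Strict Implicit.
Unset Printing Implicit Defensive.

Import Order.TTheory GRing.Theory Num.Theory.
Import numFieldNormedType.Exports.

Local Open Scope classical_set_scope.
Local Open Scope ring_scope.

(** * Euclidean inner product on column vectors and its comparison with the max norm *)

Section InnerProduct.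
Context {R : realType} {n : nat}.
Implicit Types (x y w : 'cV[R]_n) (a : R).

Lemma dotpC x y : dotp x y = dotp y x.
Proof. by apply: eq_bigr => i _; rewrite mulrC. Qed.

Lemma dotpDl x y w : dotp (x + y) w = dotp x w + dotp y w.
Proof. by rewrite -big_split; apply: eq_bigr => i _; rewrite !mxE mulrDl. Qed.

Lemma dotpZl a x y : dotp (a *: x) y = a * dotp x y.
Proof. by rewrite mulr_sumr; apply: eq_bigr => i _; rewrite !mxE mulrA. Qed.

Lemma dotpNl x y : dotp (- x) y = - dotp x y.
Proof. by rewrite -scaleN1r dotpZl mulN1r. Qed.

Lemma dotpDr x y w : dotp x (y + w) = dotp x y + dotp x w.
Proof. by rewrite dotpC dotpDl !(dotpC x). Qed.

Lemma dotpZr a x y : dotp x (a *: y) = a * dotp x y.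
Proof. by rewrite dotpC dotpZl dotpC. Qed.

Lemma dotpNr x y : dotp x (- y) = - dotp x y.
Proof. by rewrite dotpC dotpNl dotpC. Qed.

Definition dotpE := (dotpDl, dotpDr, dotpNl, dotpNr, dotpZl, dotpZr).

Lemma dotp0l x : dotp 0 x = 0.
Proof. by rewrite -(scale0r 0) dotpZl mul0r. Qed.

Lemma dotp_ge0 x : 0 <= dotp x x.
Proof. by apply: sumr_ge0 => i _; rewrite -expr2 sqr_ge0. Qed.

Lemma enorm_ge0 x : 0 <= enorm x.
Proof. exact: sqrtr_ge0. Qed.

Lemma sqr_enorm x : enorm x ^+ 2 = dotp x x.
Proof. by rewrite sqr_sqrtr // dotp_ge0. Qed.

Lemma sqr_coord_le_dotp x i : x i 0 ^+ 2 <= dotp x x.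
Proof.
rewrite /dotp (bigD1 i) //= expr2 lerDl sumr_ge0 // => j _.
by rewrite -expr2 sqr_ge0.
Qed.

Lemma dotp_eq0 x : dotp x x <= 0 -> x = 0.
Proof.
move=> x0; apply/matrixP => i j; rewrite mxE ord1; apply/eqP.
by rewrite -sqrf_eq0 eq_le sqr_ge0 (le_trans (sqr_coord_le_dotp _ _)).
Qed.

Lemma norm_coord_le x i : `|x i 0| <= `|x|.
Proof.
rewrite [leRHS]/Num.Def.normr /= mx_normrE.
by apply/bigmax_geP; right; exists (i, 0).
Qed.

Lemma norm_le_enorm x : `|x| <= enorm x.
Proof.
rewrite [leLHS]/Num.Def.normr /= mx_normrE; apply/bigmax_leP; split => /= [|[i j] _ /=].
  exact: enorm_ge0.
rewrite ord1 -(@ler_pXn2r _ 2) // ?nnegrE ?enorm_ge0 //.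
by rewrite real_normK ?num_real // sqr_enorm sqr_coord_le_dotp.
Qed.

Lemma dotp_le_norm x : dotp x x <= n%:R * `|x| ^+ 2.
Proof.
rewrite /dotp -[n in n%:R]card_ord -sumr_const mulr_suml ler_sum // => i _.
rewrite mul1r -expr2 -real_normK ?num_real //.
by rewrite ler_pXn2r ?nnegrE // norm_coord_le.
Qed.

Lemma cauchy_schwarz x y : dotp x y ^+ 2 <= dotp x x * dotp y y.
Proof.
have [y0|y_gt0] := leP (dotp y y) 0.
  by rewrite (dotp_eq0 y0) dotpC !dotp0l expr0n /= mulr0.
have := dotp_ge0 (dotp y y *: x - dotp x y *: y).
rewrite !dotpE (dotpC y x) => h.
rewrite -subr_ge0 -(pmulr_rge0 _ y_gt0).
by apply: le_trans h _; rewrite le_eqVlt; apply/orP; left; apply/eqP; ring.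
Qed.

Lemma dotp_le_sqr_enorm L x y : 0 <= L -> enorm x <= L * enorm y ->
  dotp x x <= L ^+ 2 * dotp y y.
Proof.
move=> L0 xy; rewrite -!sqr_enorm -exprMn.
by rewrite ler_pXn2r ?nnegrE ?mulr_ge0 ?enorm_ge0.
Qed.

Lemma dotp_le_of_enorm L x y : 0 <= L -> enorm x <= L * enorm y ->
  `|dotp x y| <= L * dotp y y.
Proof.
move=> L0 xy; rewrite -(@ler_pXn2r _ 2) ?nnegrE ?mulr_ge0 ?dotp_ge0 //.
rewrite real_normK ?num_real //.
apply: le_trans (cauchy_schwarz x y) _.
have -> : (L * dotp y y) ^+ 2 = L ^+ 2 * dotp y y * dotp y y by ring.
by apply: ler_wpM2r; [exact: dotp_ge0|exact: dotp_le_sqr_enorm].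
Qed.

End InnerProduct.

Lemma dotp_mulmx {R : realType} {p n : nat} (C : 'M[R]_(p, n)) x y :
  dotp (C *m x) y = dotp x (C^T *m y).
Proof.
rewrite /dotp; under eq_bigr do rewrite mxE mulr_suml.
rewrite exchange_big; apply: eq_bigr => j _ /=.
rewrite mxE mulr_sumr; apply: eq_bigr => i _; rewrite mxE; ring.
Qed.

(** * Limits of vectors and matrices, reduced to their entries *)

Section Convergence.
Context {R : realType} {T : Type} {F : set_system T} {FF : Filter F}.

Lemma mx_cvg {m n} (xs : T -> 'M[R]_(m, n)) (x : 'M[R]_(m, n)) :
  (forall i j, xs t i j @[t --> F] --> x i j) -> xs @ F --> x.
Proof.
move=> h; apply/cvgrPdist_le => e e0.
have : \forall t \near F, forall ij : 'I_m * 'I_n, `|x ij.1 ij.2 - xs t ij.1 ij.2| <= e.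
  by apply: filter_forall => -[i j] /=; have /cvgrPdist_le/(_ e e0) := h i j.
apply: filterS => t ht; rewrite [leLHS]/Num.Def.normr /= mx_normrE.
by apply/bigmax_leP; split => /= [|ij _]; [exact: ltW|rewrite !mxE].
Qed.

Lemma cvg_coord {m n} {xs : T -> 'M[R]_(m, n)} {x : 'M[R]_(m, n)} i j :
  xs @ F --> x -> xs t i j @[t --> F] --> x i j.
Proof.
move=> h; apply: (cvg_comp _ (fun M : 'M[R]_(m, n) => M i j) h).
exact: coord_continuous.
Qed.

Lemma cvg_sum {I : Type} (r : seq I) (f : I -> T -> R) (l : I -> R) :
  (forall i, f i t @[t --> F] --> l i) ->
  \sum_(i <- r) f i t @[t --> F] --> \sum_(i <- r) l i.
Proof. by move=> h; apply: cvg_big => //; exact: add_continuous. Qed.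

Lemma cvg_mulmx {m n l} (C : 'M[R]_(m, n)) (xs : T -> 'M[R]_(n, l)) x :
  xs @ F --> x -> (C *m xs t) @[t --> F] --> C *m x.
Proof.
move=> h; apply: mx_cvg => i j; rewrite mxE.
under eq_cvg do rewrite mxE.
apply: (cvg_sum (f := fun k t => C i k * xs t k j)) => k.
by apply: cvgMl_tmp; exact: cvg_coord.
Qed.

Lemma cvg_dotp {n} (xs ys : T -> 'cV[R]_n) x y :
  xs @ F --> x -> ys @ F --> y -> dotp (xs t) (ys t) @[t --> F] --> dotp x y.
Proof.
move=> hx hy.
apply: (cvg_sum (f := fun k t => xs t k 0 * ys t k 0)) => k.
by apply: cvgM; exact: cvg_coord.
Qed.

Lemma cvg_of_sqr_enorm {n} (xs : T -> 'cV[R]_n) x (e : T -> R) :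
  (forall t, dotp (xs t - x) (xs t - x) <= e t) ->
  e @ F --> (0 : R) -> xs @ F --> x.
Proof.
move=> h he; apply/cvgrPdist_le => d d0.
have /cvgrPdist_le/(_ (d ^+ 2)) := he; rewrite exprn_gt0 // => /(_ isT).
apply: filterS => t; rewrite sub0r normrN => /(le_trans (ler_norm _)) et.
rewrite distrC (le_trans (norm_le_enorm _)) //.
by rewrite -(@ler_pXn2r _ 2) ?nnegrE ?enorm_ge0 ?(ltW d0) // sqr_enorm (le_trans (h t)).
Qed.

End Convergence.

(** * Derivatives along lines and quadratic minorants *)

Section QuadraticBounds.
Context {R : realType} {n : nat}.
Implicit Types x y d : 'cV[R]_n.

Lemma is_derive_line (f : 'cV[R]_n -> R) x d (t : R) :
  differentiable f (x + t *: d) ->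
  is_derive t 1 (fun t => f (x + t *: d)) ('D_d f (x + t *: d)).
Proof.
move=> df.
have E : (fun h : R => h^-1 *: (f (x + (h%:A + t) *: d) - f (x + t *: d))) =
         (fun h : R => h^-1 *: ((f \o shift (x + t *: d)) (h *: d) - f (x + t *: d))).
  apply/funext => h /=. by rewrite -[h%:A]/(h * 1) mulr1 scalerDl addrCA.
split; last by rewrite /derive E.
by rewrite /derivable E; exact: diff_derivable.
Qed.

Lemma derive_dotp_grad (F : 'cV[R]_n -> \bar R) x d :
  differentiable (fine \o F) x -> 'D_d (fine \o F) x = dotp (grad F x) d.
Proof.
move=> dF; rewrite deriveE // [d in LHS](matrix_sum_delta d) linear_sum.
apply: eq_bigr => i _; rewrite big_ord1 linearZ /= mxE deriveE // mulrC.
by congr (_ * _).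
Qed.

(** Mean value theorem for [g], which is [f] along the segment minus the claimed minorant and has a
    nonnegative derivative on (0, 1). The sign of [a] is free and [G] is abstract, so the lemma also
    applies to the negative of a smooth function. *)
Lemma gradient_lower_bound (f : 'cV[R]_n -> R) (G : 'cV[R]_n -> 'cV[R]_n) a :
  (forall x, differentiable f x) ->
  (forall x d, 'D_d f x = dotp (G x) d) ->
  (forall x y, a * dotp (x - y) (x - y) <= dotp (G x - G y) (x - y)) ->
  forall x y, f x + dotp (G x) (y - x) + a / 2 * dotp (y - x) (y - x) <= f y.
Proof.
move=> df DfG monoG x y; set d := y - x.
have <- : x + d = y by rewrite addrC subrK.
clearbody d; clear y.
pose g (t : R) := f (x + t *: d) - (t * dotp (G x) d + t ^+ 2 * (a / 2 * dotp d d)).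
have dg (t : R) : is_derive t 1 g
    (dotp (G (x + t *: d)) d - (dotp (G x) d + t * (a * dotp d d))).
  have := is_derive_line (df (x + t *: d)); rewrite DfG => ?.
  apply: is_derive_eq; rewrite /GRing.scale /=.
  by congr (_ - _); field.
have [|t /[!in_itv]/= /andP[t0 t1]] := MVT ltr01 (fun t _ => dg t).
  apply: continuous_subspaceT => t.
  by apply/differentiable_continuous/derivable1_diffP; exact: ex_derive.
rewrite /g scale1r scale0r addr0 => E.
(* Both sides of monotonicity between [x + t *: d] and [x] carry a factor [t], which is divided
   out. *)
have := monoG (x + t *: d) x; rewrite [_ - x]addrAC subrr add0r !dotpE => h.
have {}h : t * (a * dotp d d) <= dotp (G (x + t *: d)) d - dotp (G x) d.
  by rewrite -(ler_pM2l t0); lra.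
lra.
Qed.

End QuadraticBounds.

(** * Minimizers of a function plus a quadratic penalty in [C *m x] *)

Section Penalty.
Context {R : realType} {p n : nat}.
Variables (f : 'cV[R]_n -> \bar R) (C : 'M[R]_(p, n)) (b : R).
Hypothesis f_gtNy : forall x, (-oo < f x)%E.

Definition penalized (a : 'cV[R]_p) (x : 'cV[R]_n) : \bar R :=
  (f x + (b * enorm (C *m x - a) ^+ 2)%:E)%E.

(** A minimizer has a finite value and points where [f] is infinite impose no constraint, so
    minimality becomes a family of real inequalities. *)
Lemma argmin_penalizedP a x :
  argmin (penalized a) x <->
  exists2 r : R, f x = r%:E & forall y t, f y = t%:E ->
    r + b * dotp (C *m x - a) (C *m x - a)
      <= t + b * dotp (C *m y - a) (C *m y - a).
Proof.
rewrite /argmin /penalized /=; split=> [[]|[r fx h]].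
- case: (f x) (f_gtNy x) => // r _ _ h; exists r => // y t fy.
  by have := h y; rewrite fy !sqr_enorm -!EFinD lee_fin.
- split=> [|y]; first by rewrite fx -EFinD ltry.
  case fy: (f y) (f_gtNy y) => [t| |] // _.
    by rewrite fx !sqr_enorm -!EFinD lee_fin; exact: h.
  by rewrite addye // leey.
Qed.

(** The constant is the squared Frobenius norm of [C]: Cauchy-Schwarz is applied to each row. *)
Lemma dotp_mulmx_le x : dotp (C *m x) (C *m x) <=
  (\sum_i dotp (row i C)^T (row i C)^T) * dotp x x.
Proof.
rewrite mulr_suml ler_sum // => i _; rewrite -expr2.
have -> : (C *m x) i 0 = dotp (row i C)^T x.
  by rewrite mxE; apply: eq_bigr => j _; rewrite !mxE.
exact: cauchy_schwarz.
Qed.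

(** Expanding the penalty at [y] around [x] leaves a linear term and [b |C (y - x)|^2], which is
    o(|y - x|). The vector is thus a regular subgradient, and constant sequences make it a limiting
    one. *)
Lemma argmin_penalized_subdiff a x : 0 <= b -> argmin (penalized a) x ->
  subdiff f x (- (2 * b) *: (C^T *m (C *m x - a))).
Proof.
move=> b0 /argmin_penalizedP[r fx h].
suff fr : regular_subdiff f x (- (2 * b) *: (C^T *m (C *m x - a))).
  split; first by rewrite fx.
  by exists (fun=> x), (fun=> - (2 * b) *: (C^T *m (C *m x - a)));
    split => //; exact: cvg_cst.
split=> [|e e0]; first by rewrite fx.
set K := \sum_i dotp (row i C)^T (row i C)^T.
have K0 : 0 <= K by apply: sumr_ge0 => i _; exact: dotp_ge0.
have bK1 : 0 < b * K + 1 by rewrite ltr_wpDl ?mulr_ge0.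
have : dotp (y - x) (y - x) @[y --> x] --> dotp (x - x) (x - x).
  have yx : (y - x) @[y --> x] --> x - x. by exact: (cvgB cvg_id (cvg_cst x)).
  exact: (@cvg_dotp _ _ (nbhs x) _ _ _ _ _ _ yx yx).
(* Within radius [e / (b * K + 1)] the quadratic remainder is at most [e |y - x|]; the summand 1
   keeps the denominator positive when [b * K] vanishes. *)
rewrite subrr dotp0l => /cvgrPdist_le/(_ ((e / (b * K + 1)) ^+ 2)).
rewrite exprn_gt0 ?divr_gt0 // => /(_ isT); apply: filterS => y.
rewrite sub0r normrN => /(le_trans (ler_norm _)).
rewrite -sqr_enorm ler_pXn2r ?nnegrE ?enorm_ge0 ?divr_ge0 ?(ltW e0) ?(ltW bK1) //.
rewrite ler_pdivlMr // => ye.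
case fy: (f y) (f_gtNy y) => [t| |] // _; last by rewrite leey.
rewrite fx -EFinD lee_fin.
have := h _ _ fy; have Cle := dotp_mulmx_le (y - x); rewrite -/K in Cle.
have -> : C *m y - a = (C *m x - a) + C *m (y - x).
  by rewrite mulmxBr addrAC [C *m x + _]addrC subrK.
rewrite dotpZl [dotp (C^T *m _) _]dotpC.
move: (C *m x - a) Cle => w Cle.
rewrite -dotp_mulmx !dotpE (dotpC _ w).
have : b * dotp (C *m (y - x)) (C *m (y - x)) <= b * (K * dotp (y - x) (y - x)).
  exact: ler_wpM2l.
have : b * (K * dotp (y - x) (y - x)) <= e * enorm (y - x).
  rewrite -sqr_enorm expr2 !mulrA ler_wpM2r ?enorm_ge0 //.
  apply: le_trans ye; rewrite mulrC ler_wpM2l ?enorm_ge0 //; lra.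
lra.
Qed.

(** For a fixed competitor [y], minimality bounds [f (xs k)] by reals converging to the bound wanted
    for [f x]; lower semicontinuity transfers it to the limit. *)
Lemma argmin_penalized_closed {T : Type} {F : set_system T} {FF : ProperFilter F}
    (xs : T -> 'cV[R]_n) (as_ : T -> 'cV[R]_p)
    (x : 'cV[R]_n) (a : 'cV[R]_p) :
  lower_semicontinuous f -> xs @ F --> x -> as_ @ F --> a ->
  (forall t, argmin (penalized (as_ t)) (xs t)) -> argmin (penalized a) x.
Proof.
move=> f_lsc xsx asa xs_min.
have key y t : f y = t%:E ->
    (f x <= (t + b * dotp (C *m y - a) (C *m y - a)
               - b * dotp (C *m x - a) (C *m x - a))%:E)%E.
  move=> fy; set r := (X in (X)%:E).
  have rE : (t + b * dotp (C *m y - as_ k) (C *m y - as_ k)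
     - b * dotp (C *m xs k - as_ k) (C *m xs k - as_ k)) @[k --> F] --> r.
    apply: cvgB.
      apply: cvgD; first exact: cvg_cst.
      apply: cvgMl_tmp.
      by apply: cvg_dotp; apply: cvgB => //; exact: cvg_cst.
    by apply: cvgMl_tmp; apply: cvg_dotp; apply: cvgB => //; exact: cvg_mulmx.
  apply/lee_addgt0Pr => e e0; rewrite leNgt; apply/negP => /f_lsc[V xV Vf].
  have near1 : \forall k \near F, V (xs k) by exact: xsx.
  move/cvgrPdist_le: rE => /(_ e e0) near2.
  have absurd_le (r1 e1 q s1 : R) :
      r1 + e1 < s1 -> s1 <= q -> - e1 <= r1 - q -> False by lra.
  have [k [/Vf lt_f]] := filter_ex (filterI near1 near2).
  have /argmin_penalizedP[s fs /(_ _ _ fy)] := xs_min k.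
  move: lt_f; rewrite fs lte_fin -lerBrDr ler_norml => lt_s le_s /andP[le_q _].
  exact: absurd_le lt_s le_s le_q.
(* The filter is proper, so some [xs k] exists; as a competitor of finite value it shows that [f x]
   is finite. *)
have [k _] := filter_ex (@filterT _ F _).
have /argmin_penalizedP[s fs _] := xs_min k.
apply/argmin_penalizedP.
case fx: (f x) (f_gtNy x) => [r| |] // _; last by have := key _ _ fs; rewrite fx.
by exists r => // y t fy; have := key _ _ fy; rewrite fx lee_fin; lra.
Qed.

(** The penalty is constant on each fibre of [C], so one may first minimize [f] over the fibre. This
    turns the subproblems in x and z into proximal points of the image functions. *)
Lemma argmin_image_fun a x : argmin (penalized a) x ->
  argmin (fun w => (image_fun C f w + (b * enorm (w - a) ^+ 2)%:E)%E) (C *m x).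
Proof.
move=> /argmin_penalizedP[r fx h].
have leCx : (image_fun C f (C *m x) <= r%:E)%E.
  by apply: ereal_inf_lbound; exists x.
split=> [|w].
  by rewrite lte_add_pinfty ?ltry // (le_lt_trans leCx) ?ltry.
apply: (@le_trans _ _ (r + b * enorm (C *m x - a) ^+ 2)%:E).
  by rewrite EFinD leeD2r.
rewrite -leeBlDr // -EFinB; apply/ereal_infP => _ [y <- <-].
case fy: (f y) (f_gtNy y) => [t| |] // _; last by rewrite leey.
by rewrite lee_fin !sqr_enorm lerBlDr; exact: h.
Qed.

End Penalty.

(** * Extraction of convergent subsequences *)

Section Subsequences.
Context {R : realType}.

(** Each index is chosen beyond the previous one, with a term within 1/(k+1) of [a]. *)
Lemma cluster_subseq {V : normedModType R} (xs : nat -> V) (a : V) :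
  cluster (xs @ \oo) a ->
  exists ks, increasing_seq ks /\ (xs \o ks) @ \oo --> a.
Proof.
move=> xa.
have ex (N k : nat) : {n : nat | (N < n)%N /\ `|a - xs n| < k.+1%:R^-1}.
  apply/cid; have [||_ [[n /= Nn <-]] an] :=
    xa (xs @` [set n | (N < n)%N]) (ball a k.+1%:R^-1).
  - by exists N.+1 => // n /= Nn; exists n.
  - exact: nbhsx_ballx.
  - by exists n; split => //; rewrite -ball_normE in an.
pose ks := fix ks k := if k is k'.+1 then sval (ex (ks k') k) else sval (ex 0 0).
exists ks; split; first by apply/increasing_seqP => k; have [] := svalP (ex (ks k) k.+1).
have ks_near k : `|a - xs (ks k)| < k.+1%:R^-1.
  by case: k => [|k]; [have [] := svalP (ex 0 0)|have [] := svalP (ex (ks k) k.+1)].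
apply/cvgrPdist_lt => e e0.
have := near_infty_natSinv_lt (PosNum e0); apply: filterS => k /=.
exact/lt_trans/ks_near.
Qed.

Lemma bounded_subseq {n} (xs : nat -> 'cV[R]_n) (M : R) :
  (forall k, dotp (xs k) (xs k) <= M) ->
  exists ks (a : 'cV[R]_n), increasing_seq ks /\ (xs \o ks) @ \oo --> a.
Proof.
(* Bolzano-Weierstrass on the transposed sequence. The radius [M + 1] works because each squared
   entry is at most [M], hence at most [(M + 1) ^+ 2]. *)
move=> xsM; pose A := closed_ball (0 : 'rV[R]_n) (M + 1).
have M0 : 0 <= M := le_trans (dotp_ge0 _) (xsM 0%N).
have M1 : 0 < M + 1 by rewrite ltr_wpDl.
have AE : A = [set y | `|y| <= M + 1].
  by rewrite /A closed_ballE //; apply/seteqP; split => y /=; rewrite /closed_ball_ /= sub0r normrN.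
have cA : compact A.
  apply: bounded_closed_compact; last exact: closed_ball_closed.
  exists (M + 1); split => [|N MN y]; first exact: num_real.
  by rewrite AE /= => /le_trans; apply; exact: ltW.
have xsA : ((fun k => (xs k)^T) @ \oo) A.
  exists 0%N => // k _; rewrite /= AE /=.
  rewrite [leLHS]/Num.Def.normr /= mx_normrE.
  apply/bigmax_leP; split => /= [|[i j] _ /=]; first exact: ltW.
  rewrite ord1 mxE -(@ler_pXn2r _ 2) // ?nnegrE ?(ltW M1) //.
  rewrite real_normK ?num_real // (le_trans (sqr_coord_le_dotp _ _)) //.
  by rewrite (le_trans (xsM k)) // expr2; nra.
have [y [_ /cluster_subseq[ks [kinc kcvg]]]] := cA _ _ xsA.
exists ks, y^T; split => //; apply: mx_cvg => i j; rewrite mxE.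
have := cvg_coord (i := j) (j := i) kcvg.
by under eq_cvg do rewrite /= mxE.
Qed.

Lemma cvg_subseq {T : topologicalType} (xs : nat -> T) (a : T) (ks : nat -> nat) :
  increasing_seq ks -> xs @ \oo --> a -> (xs \o ks) @ \oo --> a.
Proof.
move=> kinc xa; apply: cvg_comp xa.
apply/cvgnyPge => N; exists N => // k /= Nk; apply: leq_trans Nk _.
elim: k => // k IH; apply: leq_ltn_trans IH _.
by have /increasing_seqP := kinc; apply.
Qed.

End Subsequences.

(** * Lower bounds on the Bregman distance between two quadratic envelopes *)

Section SmoothFunction.
Context {R : realType} {n : nat}.
Variables (F : 'cV[R]_n -> R) (G : 'cV[R]_n -> 'cV[R]_n).
Implicit Types x y u v : 'cV[R]_n.

(* The lower bound at [x] and the upper bound at [y] are compared at the point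
   [y - (l - a)^-1 *: (G y - G x - a *: (y - x))]. *)
Lemma bregman_lower_bound (a l : R) :
  a < l ->
  (forall x y, F x + dotp (G x) (y - x) + a / 2 * dotp (y - x) (y - x) <= F y) ->
  (forall x y, F y <= F x + dotp (G x) (y - x) + l / 2 * dotp (y - x) (y - x)) ->
  forall x y,
    a / 2 * dotp (y - x) (y - x)
      + (2 * (l - a))^-1
          * dotp (G y - G x - a *: (y - x)) (G y - G x - a *: (y - x))
      <= F y - F x - dotp (G x) (y - x).
Proof.
move=> al lo up x y; set d := y - x.
have yE : y = x + d by rewrite addrC subrK.
set e := G y - G x.
have GyE : G y = G x + e by rewrite addrC subrK.
set q := e - a *: d; have eE : e = q + a *: d by rewrite subrK.
have la : 0 < l - a by rewrite subr_gt0.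
pose k := (l - a)^-1.
have kl : k * (l - a) = 1 by rewrite mulVf ?gt_eqF.
have := le_trans (lo x (y - k *: q)) (up y (y - k *: q)).
have -> : y - k *: q - x = d - k *: q by rewrite addrAC.
have -> : y - k *: q - y = - (k *: q) by rewrite addrAC subrr add0r.
rewrite GyE eE; clearbody q d; rewrite !dotpE (dotpC q d).
have -> : (2 * (l - a))^-1 = k / 2 by rewrite invfM mulrC.
move: (dotp q q) (dotp d q) (dotp d d) (dotp (G x) q) (dotp (G x) d) => Q W D p1 p2 h.
have kQ : k * (l - a) * (k * Q) = k * Q by rewrite kl mul1r.
lra.
Qed.

(** The bound at [x], [y] is scaled by [2 * (l + a)]. What it gives beyond the claim is [- 2 * a]
    times the slack in the sum of the bounds for both orders of the points, hence nonnegative. *)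
Lemma bregman_cocoercive (a l : R) : a <= 0 -> 0 < l + 2 * a ->
  (forall x y, F x + dotp (G x) (y - x) + a / 2 * dotp (y - x) (y - x) <= F y) ->
  (forall x y, F y <= F x + dotp (G x) (y - x) + l / 2 * dotp (y - x) (y - x)) ->
  forall x y,
    a * l * dotp (y - x) (y - x) + dotp (G y - G x) (G y - G x)
      <= 2 * (l + a) * (F y - F x - dotp (G x) (y - x)).
Proof.
move=> a0 la lo up x y.
have al : a < l by lra.
have la0 : 0 < l - a by lra.
have := bregman_lower_bound al lo up x y; have := bregman_lower_bound al lo up y x.
have -> : G x - G y - a *: (x - y) = - (G y - G x - a *: (y - x)).
  by rewrite -(opprB (G y)) -(opprB y x) scalerN -opprD.
have -> : dotp (G y) (x - y) = - dotp (G y - G x) (y - x) - dotp (G x) (y - x).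
  by rewrite -(opprB y x) dotpNr !dotpE; ring.
rewrite -(opprB y x); move: (y - x) (G y - G x) => d e.
rewrite !dotpE (dotpC e d); set k := (2 * (l - a))^-1.
have kl : k * (2 * (l - a)) = 1 by rewrite mulVf // gt_eqF // mulr_gt0.
clearbody k.
move: (dotp e e) (dotp d e) (dotp d d) (dotp (G x) d) (F x) (F y) => E P D g fx fy h1 h2.
(* Adding [h1] and [h2] cancels the values of [F]. *)
have h : 0 <= - a * (P - a * D - 2 * (k * (E - 2 * a * P + a ^+ 2 * D))).
  apply: mulr_ge0; first lra.
  by lra.
have := ler_wpM2l (_ : 0 <= 2 * (l + a)) h2 => /(_ ltac:(lra)).
have klE : k * (2 * (l - a)) * (E - 2 * a * P + a ^+ 2 * D) = E - 2 * a * P + a ^+ 2 * D.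
  by rewrite kl mul1r.
lra.
Qed.

End SmoothFunction.

(** * One Douglas-Rachford step and the proximal map of a smooth function *)

Section DouglasRachford.
Context {R : realType} {p : nat}.
Variables (F : 'cV[R]_p -> R) (G : 'cV[R]_p -> 'cV[R]_p) (L a gamma : R).
Hypotheses (gamma_gt0 : 0 < gamma) (L_ge0 : 0 <= L) (gammaL : gamma * L < 1).
Hypothesis lo :
  forall x y, F x + dotp (G x) (y - x) + a / 2 * dotp (y - x) (y - x) <= F y.
Hypothesis up :
  forall x y, F y <= F x + dotp (G x) (y - x) + L / 2 * dotp (y - x) (y - x).
Hypothesis lip :
  forall x y, dotp (G x - G y) (G x - G y) <= L ^+ 2 * dotp (x - y) (x - y).
Implicit Types s u v w : 'cV[R]_p.

Let gammaV : gamma * gamma^-1 = 1.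
Proof. by rewrite mulfV // gt_eqF. Qed.

(** The objective minimized in the DR envelope, taken at [v], with [h] standing for the value of the
    second function there. *)
Definition DR_value (h : R) u v : R :=
  F u + h + (dotp (G u) (v - u) + (2 * gamma)^-1 * dotp (v - u) (v - u)).

Lemma DR_value_ge h u v :
  F v + h + (gamma^-1 - L) / 2 * dotp (v - u) (v - u) <= DR_value h u v.
Proof.
have := up u v; rewrite /DR_value invfM.
by move: (dotp (v - u) (v - u)) (dotp (G u) (v - u)) => D g; lra.
Qed.

(** With [s = u + gamma *: G u] and likewise for [u'], the equation on [u'] says that the new point
    is [s + v - u]. Keeping the same [v] makes [h] cancel. *)
Lemma DR_descent : a <= 0 -> 0 < 1 + 2 * gamma * a ->
  exists2 kappa : R, 0 < kappa & forall h u u' v,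
    u' + gamma *: G u' = v + gamma *: G u ->
    DR_value h u' v + kappa * dotp (v - u) (v - u) <= DR_value h u v.
Proof.
move=> a_le0 gamma_a; pose l := gamma^-1.
have l0 : 0 < l by rewrite invr_gt0.
have gl : gamma * l = 1 by exact: gammaV.
have la2 : 0 < l + 2 * a.
  have -> : l + 2 * a = l * (1 + 2 * gamma * a) + 2 * a * (1 - gamma * l) by ring.
  by rewrite gl subrr mulr0 addr0 mulr_gt0.
have la : 0 < l + a by lra.
have Ll : L < l.
  by rewrite -(ltr_pM2l gamma_gt0) gl.
have up_l x y : F y <= F x + dotp (G x) (y - x) + l / 2 * dotp (y - x) (y - x).
  apply: le_trans (up x y) _; rewrite lerD2l ler_wpM2r ?dotp_ge0 //; lra.
(* [C] is the coefficient of [|d|^2] that remains after inserting the cocoercive bound with modulus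
   [l] and [|e| <= L |d|]. *)
pose C := (l ^+ 2 - L ^+ 2) * (1 + 2 * gamma * a) / (2 * (l + a)).
have Llsq : 0 < l ^+ 2 - L ^+ 2 by rewrite subr_gt0 ltr_pXn2r ?nnegrE // ltW.
have CE : 2 * (l + a) * C = (l ^+ 2 - L ^+ 2) * (1 + 2 * gamma * a).
  by rewrite /C mulrC divfK // gt_eqF // mulr_gt0.
have C0 : 0 < C by rewrite divr_gt0 // mulr_gt0.
(* The factor 4 passes from [d] to [v - u = d + gamma *: e]: since [gamma |e| <= |d|], its squared
   norm is at most [4 |d|^2]. *)
exists (C / 4) => [|h u u' v vE]; first by rewrite divr_gt0.
have := bregman_cocoercive a_le0 la2 lo up_l u' u.
have := lip u' u.
pose e := G u' - G u; pose d := u' - u.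
have uE' : u' = u + d by rewrite addrC subrK.
have GE' : G u' = G u + e by rewrite addrC subrK.
have vE' : v = u + d + gamma *: e.
  by rewrite scalerBr addrA -uE' vE addrK.
rewrite /DR_value {}vE'.
have -> : u + d + gamma *: e - u' = gamma *: e by rewrite uE' [LHS]addrAC subrr add0r.
have -> : u + d + gamma *: e - u = d + gamma *: e.
  by rewrite -[u + d + _]addrA [LHS]addrAC subrr add0r.
rewrite -(opprB u' u) -(opprB (G u') (G u)) -/d -/e GE'.
have := dotp_ge0 (d - gamma *: e); have := dotp_ge0 e; have := dotp_ge0 d.
clearbody d e; rewrite !dotpE (dotpC e d) (_ : (2 * gamma)^-1 = l / 2); last first.
  by rewrite invfM mulrC.
move: (dotp e e) (dotp d e) (dotp d d) (dotp (G u) d) (dotp (G u) e) (F u) (F u').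
move=> E P D gd ge f f' D0 E0 dP EL breg.
have gE : gamma ^+ 2 * E <= D.
  apply: (@le_trans _ _ (gamma ^+ 2 * (L ^+ 2 * D))).
    by rewrite ler_wpM2l // exprn_ge0 // ltW.
  rewrite mulrA -exprMn ler_piMl // exprn_ile1 ?mulr_ge0 //; exact: ltW.
have CD : C * (D + 2 * gamma * P + gamma ^+ 2 * E) <= C * (4 * D).
  by rewrite ler_wpM2l ?(ltW C0) //; lra.
pose Dv := f - f' + gd + P.
have breg' : a * l * D + E <= 2 * (l + a) * Dv.
  by apply: le_trans (le_trans _ breg) _; rewrite /Dv; lra.
have main : C * D <= Dv - gamma * E + l / 2 * D.
  have h2 : 0 < 2 * (l + a) by rewrite mulr_gt0.
  rewrite -(ler_pM2l h2) mulrA CE.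
  have EL' : (1 + 2 * gamma * a) * E <= (1 + 2 * gamma * a) * (L ^+ 2 * D).
    by rewrite ler_wpM2l ?(ltW gamma_a).
  have g1 : 2 * (l + a) * (gamma * E) = 2 * (1 + gamma * a) * E.
    by transitivity (2 * (gamma * l + gamma * a) * E); [ring|rewrite gl].
  have g2 : (l ^+ 2) * (2 * gamma * a) = 2 * l * a.
    by transitivity (2 * (gamma * l) * l * a); [ring|rewrite gl mulr1].
  have g3 : (l ^+ 2) * (2 * gamma * a) * D = 2 * l * a * D by rewrite g2.
  have -> : 2 * (l + a) * (Dv - gamma * E + l / 2 * D)
      = 2 * (l + a) * Dv - 2 * (l + a) * (gamma * E) + (l + a) * l * D by field.
  rewrite g1; lra.
have g4 : l * gamma ^+ 2 * E = gamma * E.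
  by transitivity (gamma * l * gamma * E); [ring|rewrite gl mul1r].
have g5 : l * gamma * P = P by rewrite (mulrC l) gl mul1r.
rewrite /Dv in main; lra.
Qed.

(** Testing minimality at [u - q] and using the upper bound [up], the objective would drop by at
    least [(gamma^-1 - L) / 2 * |q|^2], which forces [q = 0]. *)
Lemma prox_smooth s u : prox gamma (EFin \o F) s u -> s = u + gamma *: G u.
Proof.
move=> [_ umin]; pose q := gamma *: G u + (u - s).
suff q0 : q = 0.
  by apply/eqP; rewrite eq_sym -subr_eq0 -q0 /q addrCA addrA.
apply: dotp_eq0.
have := umin (u - q); rewrite /= -!EFinD lee_fin !sqr_enorm.
have := up u (u - q).
have -> : u - q - u = - q by rewrite addrAC subrr add0r.
have -> : u - q - s = (u - s) - q by rewrite addrAC.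
have : dotp q q = gamma * dotp (G u) q + dotp (u - s) q by rewrite -dotpZl -dotpDl.
clearbody q; move: (u - s) => r; rewrite !dotpE (dotpC q r) invfM.
have gl := gammaV; have : L < gamma^-1 by rewrite -(ltr_pM2l gamma_gt0) gl.
move: (gamma^-1) gl (F (u - q)) (F u) (dotp r r) (dotp (G u) q) (dotp r q) (dotp q q).
move=> l gl f f' rr g rq Q Ll QE h1 h2.
have lQ : l * Q = g + l * rq by rewrite QE mulrDr mulrA (mulrC l) gl mul1r.
have : (l - L) * Q <= 0 by lra.
by rewrite pmulr_rle0 // subr_gt0.
Qed.

(** The map [u + gamma *: G u] shrinks distances by a factor no smaller than [1 - gamma * L],
    because [G] is [- L]-monotone. So its inverse, the proximal map, is single-valued and
    Lipschitz. *)
Lemma smooth_prox_lipschitz u u' :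
  (1 - gamma * L) ^+ 2 * dotp (u - u') (u - u')
    <= dotp (u + gamma *: G u - (u' + gamma *: G u'))
            (u + gamma *: G u - (u' + gamma *: G u')).
Proof.
have -> : u + gamma *: G u - (u' + gamma *: G u') = (u - u') + gamma *: (G u - G u').
  by rewrite opprD addrACA scalerBr.
have := lip u u'; move: (u - u') (G u - G u') => d e Ed.
have k0 : 0 < 1 - gamma * L by rewrite subr_gt0.
have := dotp_ge0 (d + gamma *: e - (1 - gamma * L) *: d).
have dgL : - (L * dotp d d) <= dotp e d.
  apply: lerNnormlW; apply: dotp_le_of_enorm => //.
  by rewrite -(@ler_pXn2r _ 2) ?nnegrE ?mulr_ge0 ?enorm_ge0 // exprMn !sqr_enorm.
have := ler_wpM2l (mulr_ge0 (ltW k0) (ltW gamma_gt0)) dgL.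
rewrite !dotpE (dotpC d e); move: (dotp d d) (dotp e d) (dotp e e) => D P E.
lra.
Qed.

End DouglasRachford.

(** * Quadratic bounds from smoothness and hypoconvexity *)

Section SmoothBounds.
Context {R : realType} {p : nat}.
Implicit Types F : 'cV[R]_p -> \bar R.

(** This is the quadratic lower bound for the negative of [F] with modulus [- L]; Cauchy-Schwarz
    supplies the monotonicity. *)
Lemma L_smooth_upper_bound F (L : R) : 0 <= L -> L_smooth L F ->
  forall x y, fine (F y) <=
    fine (F x) + dotp (grad F x) (y - x) + L / 2 * dotp (y - x) (y - x).
Proof.
move=> L0 [[_ dF] lipF] x y.
have := @gradient_lower_bound _ _ (\- (fine \o F)) (fun x => - grad F x) (- L).
have dN w : differentiable (\- (fine \o F)) w by apply: differentiableN.
have DN w d : 'D_d (\- (fine \o F)) w = dotp (- grad F w) d.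
  by rewrite deriveN ?derive_dotp_grad ?dotpNl //; exact: diff_derivable.
move=> /(_ dN DN) lower.
have /lower/(_ x y) : forall w w', - L * dotp (w - w') (w - w')
    <= dotp (- grad F w - - grad F w') (w - w').
  move=> w w'; rewrite -opprD dotpNl mulNr lerN2.
  exact: le_trans (ler_norm _) (dotp_le_of_enorm L0 (lipF w w')).
rewrite /= dotpNl; move: (dotp _ _) (dotp _ _) => g D; lra.
Qed.

Lemma hypoconvex_lower_bound F (sigma a : R) : a <= sigma -> hypoconvex sigma F ->
  forall x y, fine (F x) + dotp (grad F x) (y - x) + a / 2 * dotp (y - x) (y - x)
    <= fine (F y).
Proof.
move=> asigma [[_ dF] monoF] x y.
have DF w d : 'D_d (fine \o F) w = dotp (grad F w) d by exact: derive_dotp_grad.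
apply: (gradient_lower_bound dF DF) => {x y} x y.
apply: le_trans (monoF x y); rewrite sqr_enorm ler_wpM2r //; exact: dotp_ge0.
Qed.

End SmoothBounds.

(** The extended inverse of 0 is [+oo]; the product form treats that case together with [t > 0]. *)
Lemma lte_inve_mul {R : realType} (t r : R) : 0 <= t ->
  (r%:E < (t%:E)^-1)%E -> r * t < 1.
Proof.
rewrite le_eqVlt => /orP[/eqP <-|t0]; first by rewrite mulr0.
by rewrite /inve gt_eqF // lte_fin -(ltr_pM2r t0) mulVf // gt_eqF.
Qed.

(** * Proximal maps as penalized problems, and their link with the subproblems *)

Section ProxImage.
Context {R : realType} {p : nat}.

Lemma proxE (gamma : R) (phi : 'cV[R]_p -> \bar R) s :
  prox gamma phi s = argmin (penalized phi 1%:M (2 * gamma)^-1 s).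
Proof.
by congr argmin; apply/funext => w; rewrite /penalized mul1mx.
Qed.

Lemma prox_X_sub {n} (f : 'cV[R]_n -> \bar R) (A : 'M[R]_(p, n)) (beta : R) s x :
  (forall x, (-oo < f x)%E) -> X_sub beta f A s x ->
  prox beta^-1 (image_fun A f) s (A *m x).
Proof. by move=> f_gtNy /(argmin_image_fun f_gtNy); rewrite /prox invfM invrK mulrC. Qed.

Lemma Z_subE {q} (g : 'cV[R]_q -> \bar R) (B : 'M[R]_(p, q)) c (beta : R) s :
  Z_sub beta g B c s = argmin (penalized g B (beta / 2) (s - c)).
Proof.
congr argmin; apply/funext => z; rewrite /Z_obj /penalized.
by rewrite opprB addrA [_ - s]addrAC.
Qed.

Lemma prox_Z_sub {q} (g : 'cV[R]_q -> \bar R) (B : 'M[R]_(p, q)) c (beta : R) s z :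
  (forall z, (-oo < g z)%E) -> Z_sub beta g B c s z ->
  prox beta^-1 (fun w => image_fun B g (w - c)) s (B *m z + c).
Proof.
move=> g_gtNy; rewrite Z_subE => /(argmin_image_fun g_gtNy)[fin_z min_z].
rewrite /prox invfM invrK (mulrC 2^-1).
have E w : w - c - (s - c) = w - s by rewrite opprB addrA subrK.
split=> [|w /=]; first by rewrite -(E (_ + c)) addrK.
by have := min_z (w - c); rewrite -!E addrK.
Qed.

End ProxImage.

Lemma xget_set1 {T : choiceType} (x0 x : T) : xget x0 [set x] = x.
Proof. exact: xget_unique. Qed.

(** * Real values of the DR envelope *)

Section Envelope.
Context {R : realType} {p : nat}.
Variables (phi1 phi2 : 'cV[R]_p -> \bar R) (gamma : R).
Hypothesis phi1_fin : forall w, phi1 w \is a fin_num.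
Hypothesis phi2_gtNy : forall w, (-oo < phi2 w)%E.
Local Notation value := (DR_value (fine \o phi1) (grad phi1) gamma).

Lemma DR_envelope_le s u w h : prox gamma phi1 s = [set u] -> phi2 w = h%:E ->
  (DR_envelope gamma phi1 phi2 s <= (value h u w)%:E)%E.
Proof.
move=> pu ph; rewrite /DR_envelope pu xget_set1.
apply: ereal_inf_lbound; exists w => //.
by rewrite ph -{1}(fineK (phi1_fin u)) sqr_enorm -!EFinD.
Qed.

(** Since [2 *: u - s = u - gamma *: grad phi1 u], completing the square makes the envelope
    objective and the proximal objective at [2 *: u - s] differ by a constant, so [v] attains the
    infimum. *)
Lemma DR_envelopeE s u v h : 0 < gamma ->
  prox gamma phi1 s = [set u] -> s = u + gamma *: grad phi1 u ->
  prox gamma phi2 (2 *: u - s) v -> phi2 v = h%:E ->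
  DR_envelope gamma phi1 phi2 s = (value h u v)%:E.
Proof.
move=> gamma0 pu sE; rewrite proxE => /(argmin_penalizedP _ _ phi2_gtNy)[r phv v_min] phv'.
have rh : r = h by apply: EFin_inj; rewrite -phv.
rewrite {}rh {phv} in v_min.
apply/eqP; rewrite eq_le (DR_envelope_le pu phv') /=.
rewrite /DR_envelope pu xget_set1; apply/ereal_infP => _ [w _ <-].
case ph: (phi2 w) (phi2_gtNy w) => [t| |] // _; last first.
  by rewrite addey ?gt_eqF ?ltNye_eq ?phi1_fin // leey.
rewrite -(fineK (phi1_fin u)) sqr_enorm -!EFinD lee_fin /DR_value /=.
have := v_min _ _ ph; rewrite !mul1mx sE.
have E x : x - (2 *: u - (u + gamma *: grad phi1 u)) = (x - u) + gamma *: grad phi1 u.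
  have -> : 2 *: u - (u + gamma *: grad phi1 u) = u - gamma *: grad phi1 u.
    by rewrite scaler_nat mulr2n opprD addrA addrK.
  by rewrite opprB addrA addrAC.
rewrite !E; move: (v - u) (w - u) (grad phi1 u) => {E} V W g.
rewrite !dotpE (dotpC V g) (dotpC W g) invfM.
have gl : gamma * gamma^-1 = 1 by rewrite mulfV // gt_eqF.
move: gamma^-1 gl (dotp V V) (dotp W W) (dotp g V) (dotp g W) (dotp g g) =>
  l gl VV WW gV gW gg.
have glV : gamma * l * gV = gV by rewrite gl mul1r.
have glW : gamma * l * gW = gW by rewrite gl mul1r.
lra.
Qed.

End Envelope.

(** [P] is monotone and bounded below, hence convergent; its consecutive differences tend to 0 and
    squeeze [r]. *)
Lemma sufficient_decrease_cvg0 {R : realType} (P r : nat -> R) (kappa m : R) :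
  0 < kappa -> (forall k, 0 <= r k) -> (forall k, m <= P k) ->
  (forall k, P k.+1 + kappa * r k <= P k) ->
  r @ \oo --> (0 : R).
Proof.
move=> k0 r0 mP dP.
have Pcvg : cvgn P.
  apply: nonincreasing_is_cvgn.
    apply/nonincreasing_seqP => k; apply: le_trans (dP k).
    by rewrite lerDl mulr_ge0 // ltW.
  by exists m => _ [k _ <-].
have : (fun k => kappa^-1 * (P k - P k.+1)) @ \oo --> (0 : R).
  rewrite -(mulr0 kappa^-1) -(subrr (limn P)); apply: cvgMl_tmp.
  by apply: cvgB => //; rewrite (cvg_shiftS P).
apply: squeeze_cvgr; last exact: cvg_cst.
apply: nearW => k; rewrite r0 /= ler_pdivlMl //.
by have := dP k; lra.
Qed.

Lemma bounded_range_of_dotp {R : realType} {n} (T : Type) (xs : T -> 'cV[R]_n) (M : R) :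
  (forall t, dotp (xs t) (xs t) <= M) -> exists N, forall t, `|xs t| <= N.
Proof.
move=> h; exists (1 + M) => t; apply: le_trans (norm_le_enorm _) _.
have := h t; rewrite -sqr_enorm; have := enorm_ge0 (xs t).
by nra.
Qed.

Lemma bounded_set_dotp {R : realType} {n} (S : set 'cV[R]_n) :
  bounded_set S -> exists M, forall x, S x -> dotp x x <= M.
Proof.
move=> [N [_ /(_ (N + 1))]]; rewrite ltrDl ltr01 => /(_ isT) SN.
exists (n%:R * (N + 1) ^+ 2) => x Sx; apply: le_trans (dotp_le_norm x) _.
by rewrite ler_wpM2l // ler_pXn2r ?nnegrE ?(le_trans (normr_ge0 x) (SN _ Sx)) ?SN.
Qed.

Lemma dotp_add_le {R : realType} {n} (x y : 'cV[R]_n) :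
  dotp (x + y) (x + y) <= 2 * dotp x x + 2 * dotp y y.
Proof. by have := dotp_ge0 (x - y); rewrite !dotpE (dotpC y x); lra. Qed.

Lemma subr_reflection {R : realType} {n} (x y : 'cV[R]_n) :
  x - (2 *: x - y) = y - x.
Proof. by rewrite scaler_nat mulr2n -addrA opprD addrA subrr sub0r opprB. Qed.

Theorem theorem4p4 (R : realType) (n q p : nat)
    (f : 'cV[R]_n -> \bar R) (g : 'cV[R]_q -> \bar R)
    (A : 'M[R]_(p, n)) (B : 'M[R]_(p, q)) (c : 'cV[R]_p)
    (beta gamma : R) (phi1 phi2 : 'cV[R]_p -> \bar R)
    (L sigma nu1 nu2 : R) (m : nat)
    (xinit : 'cV[R]_n) (yinit : 'cV[R]_p)
    (x : nat -> 'cV[R]_n) (z : nat -> 'cV[R]_q)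
    (s u v : nat -> 'cV[R]_p) (theta : nat -> nat -> R)
    (f_proper : proper_fun f) (f_lsc : lower_semicontinuous f)
    (g_proper : proper_fun g) (g_lsc : lower_semicontinuous g)
    (beta_gt0 : 0 < beta) (gammaE : gamma = beta^-1)
    (X_nonempty : forall s0 : 'cV[R]_p, X_sub beta f A s0 !=set0)
    (Z_nonempty : forall s0 : 'cV[R]_p, Z_sub beta g B c s0 !=set0)
    (phi1E : phi1 = image_fun A f)
    (phi2E : phi2 = fun w => image_fun B g (w - c))
    (A1_smooth : L_smooth L phi1) (A1_hypoconvex : hypoconvex sigma phi1)
    (A1_sigma : - L <= sigma <= L)
    (A2_lsc : lower_semicontinuous phi2) (A2_proper : proper_fun phi2)
    (A3 : argmin (fun w => (phi1 w + phi2 w)%E) !=set0)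
    (B1_nu1 : 0 < nu1) (B1_nu2 : 0 <= nu2)
    (B2 : level_bounded (fun w => (phi1 w + phi2 w)%E))
    (B3 : (gamma%:E <
           Order.min ((2 * Order.max (- sigma) 0)%:E^-1) (L%:E^-1))%E)
    (run : AADR_run f g A B c beta gamma phi1 phi2 m nu1 nu2 xinit yinit
             x z s u v theta) :
  (* (a) *)
  [/\ nonincreasing_seq (fun k => DR_envelope gamma phi1 phi2 (s k)) /\
      (fun k => enorm (v k - u k)) @ \oo --> (0 : R),
  (* (b) *)
      [/\ bounded_set (range (fun k => (s k, u k, v k))),
          (forall (ks : nat -> nat) (sstar : 'cV[R]_p),
             increasing_seq ks -> (s \o ks) @ \oo --> sstar ->
             DR_map gamma phi1 phi2 sstar sstar /\
             exists ustar : 'cV[R]_p,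
               prox gamma phi1 sstar = [set ustar] /\
               stationary_sum phi1 phi2 ustar)
        & exists (ks : nat -> nat) (sstar : 'cV[R]_p),
            increasing_seq ks /\ (s \o ks) @ \oo --> sstar]
  (* (c) *)
    & (forall s0 : 'cV[R]_p,
         level_bounded (Z_obj beta g B c s0) /\
         bounded_below (Z_obj beta g B c s0)) ->
      forall (ks : nat -> nat) (sstar ustar : 'cV[R]_p),
        increasing_seq ks -> (s \o ks) @ \oo --> sstar ->
        prox gamma phi1 sstar = [set ustar] ->
        bounded_set (range (z \o ks)) /\
        forall (xstar : 'cV[R]_n) (ystar : 'cV[R]_p) (zstar : 'cV[R]_q),
          cluster ((z \o ks) @ \oo) zstar ->
          X_sub beta f A sstar xstar ->
          ystar = ustar - sstar ->
          stationary_point f g A B c beta xstar ystar zstar].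
Proof.

(* Constants, quadratic bounds and proximal maps for the reduced problem *)
set F := fine \o phi1; set G := grad phi1; pose a := Num.min sigma 0.
have f_gtNy : forall x, (-oo < f x)%E by case: f_proper.
have g_gtNy : forall x, (-oo < g x)%E by case: g_proper.
have phi2_gtNy : forall x, (-oo < phi2 x)%E by case: A2_proper.
have phi1_fin : forall w, phi1 w \is a fin_num by case: A1_smooth => -[].
have phi1F : phi1 = EFin \o F by apply/funext => w; rewrite /= fineK.
have L0 : 0 <= L by move/andP: A1_sigma => [? ?]; lra.
have gamma0 : 0 < gamma by rewrite gammaE invr_gt0.
have a0 : a <= 0 by rewrite ge_min lexx orbT.
move: B3; rewrite lt_min => /andP[B3sigma /(lte_inve_mul L0) gammaL].
have gammaa : 0 < 1 + 2 * gamma * a.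
  have : gamma * (2 * Num.max (- sigma) 0) < 1.
    by apply: lte_inve_mul => //; rewrite mulr_ge0 // le_max lexx orbT.
  have -> : Num.max (- sigma) 0 = - a by rewrite /a -oppr0 -oppr_min oppr0.
  lra.
have up := L_smooth_upper_bound L0 A1_smooth.
have asigma : a <= sigma by rewrite ge_min lexx.
have lo := hypoconvex_lower_bound asigma A1_hypoconvex.
have lip w w' : dotp (G w - G w') (G w - G w') <= L ^+ 2 * dotp (w - w') (w - w').
  by apply: dotp_le_sqr_enorm => //; case: A1_smooth.
have b0 : 0 <= (2 * gamma)^-1 by rewrite invr_ge0 mulr_ge0 // ltW.
have proxX s0 x0 : X_sub beta f A s0 x0 -> prox gamma phi1 s0 (A *m x0).
  by rewrite gammaE phi1E; exact: prox_X_sub.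
have proxZ s0 z0 : Z_sub beta g B c s0 z0 -> prox gamma phi2 s0 (B *m z0 + c).
  by rewrite gammaE phi2E; exact: prox_Z_sub.
have prox1 s0 u0 : prox gamma phi1 s0 u0 -> s0 = u0 + gamma *: G u0.
  by rewrite {1}phi1F; exact: (prox_smooth gamma0 gammaL up).
have prox_dist s0 s1 u0 u1 : prox gamma phi1 s0 u0 -> prox gamma phi1 s1 u1 ->
    dotp (u0 - u1) (u0 - u1) <= ((1 - gamma * L) ^+ 2)^-1 * dotp (s0 - s1) (s0 - s1).
  move=> /prox1-> /prox1->; rewrite ler_pdivlMl ?exprn_gt0 ?subr_gt0 //.
  exact: (smooth_prox_lipschitz gamma0 L0 gammaL lip).
have prox_set1 s0 u0 : prox gamma phi1 s0 u0 -> prox gamma phi1 s0 = [set u0].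
  move=> pu; apply/seteqP; split => [w pw|_ -> //] /=.
  apply/eqP; rewrite -subr_eq0; apply/eqP/dotp_eq0.
  by apply: le_trans (prox_dist _ _ _ _ pw pu) _; rewrite subrr dotp0l mulr0.
have [wmin [wmin_fin wminP]] := A3.
(* [mu] is the minimum value of [phi1 + phi2], a lower bound for the envelope along the run. *)
have [mu muP] : exists mu : R, forall w, (mu%:E <= phi1 w + phi2 w)%E.
  move: wmin_fin wminP; rewrite phi1F /=.
  case: (phi2 wmin) (phi2_gtNy wmin) => [r| |] // _.
  by move=> _ ?; exists (F wmin + r).
have phi2_prox s0 w : prox gamma phi2 s0 w -> exists h : R, phi2 w = h%:E.
  by rewrite proxE => /(argmin_penalizedP _ _ phi2_gtNy)[h]; exists h.
have gapL : 0 < (gamma^-1 - L) / 2.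
  by rewrite divr_gt0 // subr_gt0 -(ltr_pM2l gamma0) mulfV // gt_eqF.
have mu_le h v0 : phi2 v0 = h%:E -> mu <= F v0 + h.
  by move=> ph; have := muP v0; rewrite ph phi1F /= -EFinD lee_fin.

(* Envelope values along the run and their sufficient decrease *)
have uk k : prox gamma phi1 (s k) (u k).
  by rewrite (run_u run); exact/proxX/(run_x run).
have vk k : prox gamma phi2 (2 *: u k - s k) (v k).
  by rewrite (run_v run); exact/proxZ/(run_z run).
have envE s0 u0 v0 h : prox gamma phi1 s0 u0 -> prox gamma phi2 (2 *: u0 - s0) v0 ->
    phi2 v0 = h%:E ->
    DR_envelope gamma phi1 phi2 s0 = (DR_value F G gamma h u0 v0)%:E.
  by move=> pu pv ph; apply: DR_envelopeE => //; [exact: prox_set1|exact: prox1].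
have env_fin s0 : DR_envelope gamma phi1 phi2 s0 \is a fin_num.
  have [x0 /proxX pu] := X_nonempty s0.
  have [z0 /proxZ pv] := Z_nonempty (2 *: (A *m x0) - s0).
  by have [h ph] := phi2_prox _ _ pv; rewrite (envE _ _ _ _ pu pv ph).
pose h k := fine (phi2 (v k)).
have hk k : phi2 (v k) = (h k)%:E.
  by have [r rE] := phi2_prox _ _ (vk k); rewrite /h rE.
pose P k := DR_value F G gamma (h k) (u k) (v k).
have PE k : DR_envelope gamma phi1 phi2 (s k) = (P k)%:E by exact: envE.
pose D k := dotp (v k - u k) (v k - u k).
have P_ge k : F (v k) + h k + (gamma^-1 - L) / 2 * D k <= P k.
  exact: (DR_value_ge _ up).
have D0 k : 0 <= D k by exact: dotp_ge0.
have P_mu k : mu <= P k.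
  apply: le_trans (P_ge k); rewrite ler_wpDr ?mu_le //.
  by rewrite mulr_ge0 ?(ltW gapL).
have [kappa kappa0 descent] := DR_descent gamma0 L0 gammaL lo up lip a0 gammaa.
(* One constant for both kinds of step: [nu1] for accepted candidates, [kappa] for plain DR
   steps. *)
pose kap := Num.min kappa nu1.
have kap0 : 0 < kap by rewrite lt_min kappa0.
have decrease k : P k.+1 + kap * D k <= P k.
  have [acc|rej] := pselect (AA_accept gamma nu1 nu2 phi1 phi2 (s k)
      (DR_step s u v k) (AA_candidate m s u v k (theta k))).
    move: (acc); rewrite /AA_accept -(run_accept run acc) !PE -EFinB lee_fin.
    have -> : DR_step s u v k - s k = v k - u k.
      by rewrite /DR_step -[_ - u k]addrA [LHS]addrAC subrr add0r.
    rewrite !sqr_enorm -/(D k).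
    have : kap * D k <= nu1 * D k by rewrite ler_wpM2r // ge_min lexx orbT.
    have : 0 <= nu2 * dotp (s k.+1 - s k) (s k.+1 - s k) by rewrite mulr_ge0 ?dotp_ge0.
    lra.
  (* After a plain step, [descent] keeps the old [v k], which is then merely a competitor in the
     envelope at [s k.+1]. *)
  have sE := run_reject run rej.
  have : DR_value F G gamma (h k) (u k.+1) (v k) + kappa * D k <= P k.
    apply: descent; rewrite -(prox1 _ _ (uk k.+1)) sE /DR_step {1}(prox1 _ _ (uk k)).
    by rewrite addrAC [u k + _]addrC addrK addrC.
  have : P k.+1 <= DR_value F G gamma (h k) (u k.+1) (v k).
    rewrite -lee_fin -PE; apply: DR_envelope_le => //.
    exact: prox_set1.
  have : kap * D k <= kappa * D k by rewrite ler_wpM2r // ge_min lexx.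
  lra.
have D_cvg : D @ \oo --> (0 : R) := sufficient_decrease_cvg0 kap0 D0 P_mu decrease.
have P_noninc : nonincreasing_seq P.
  apply/nonincreasing_seqP => k; apply: le_trans (decrease k).
  by rewrite lerDl mulr_ge0 // ltW.
have vu_cvg : (v \- u) @ \oo --> (0 : 'cV[R]_p).
  by apply: (cvg_of_sqr_enorm (e := D)) => // k; rewrite subr0.

(* Limits along subsequences and boundedness of the iterates *)
have limits ks sstar ustar : increasing_seq ks -> (s \o ks) @ \oo --> sstar ->
    prox gamma phi1 sstar ustar ->
    (u \o ks) @ \oo --> ustar /\ (v \o ks) @ \oo --> ustar.
  move=> kinc s_cvg pu.
  have u_cvg : (u \o ks) @ \oo --> ustar.
    apply: (cvg_of_sqr_enorm (e := fun k => ((1 - gamma * L) ^+ 2)^-1 *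
        dotp (s (ks k) - sstar) (s (ks k) - sstar))) => [k|].
      exact: prox_dist.
    rewrite -(mulr0 ((1 - gamma * L) ^+ 2)^-1) -(dotp0l (0 : 'cV[R]_p)) -(subrr sstar).
    apply: cvgMl_tmp.
    by apply: cvg_dotp; apply: cvgB => //; exact: cvg_cst.
  split => //; rewrite -(add0r ustar).
  have -> : v \o ks = ((v \- u) \o ks) \+ (u \o ks).
    by apply/funext => k /=; rewrite subrK.
  by apply: cvgD => //; exact: cvg_subseq.
(* [u] and [v] share the limit [ustar], so the closed graph of the proximal map of [phi2]
   applies. *)
have limit_fixed ks sstar ustar : increasing_seq ks -> (s \o ks) @ \oo --> sstar ->
    prox gamma phi1 sstar ustar -> prox gamma phi2 (2 *: ustar - sstar) ustar.
  move=> kinc s_cvg pu; have [u_cvg v_cvg] := limits _ _ _ kinc s_cvg pu.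
  rewrite proxE; apply: (argmin_penalized_closed phi2_gtNy A2_lsc v_cvg
    (as_ := fun k => 2 *: u (ks k) - s (ks k))) => [|k].
    by apply: cvgB => //; exact: cvgZl_tmp.
  by rewrite -proxE; exact: vk.
(* All [v k] lie in the level set of [phi1 + phi2] at height [P 0]. *)
have [Mv vM] : exists M, forall k, dotp (v k) (v k) <= M.
  have [M hM] := bounded_set_dotp (B2 (P 0%N)); exists M => k; apply: hM => /=.
  rewrite hk phi1F /= -EFinD lee_fin.
  apply: (@le_trans _ _ (P k)); last exact: P_noninc.
  by apply: le_trans (P_ge k); rewrite lerDl mulr_ge0 ?(ltW gapL).
(* By sufficient decrease [kap * D k] is at most [P 0 - mu], which bounds [v k - u k]. *)
have [Mu uM] : exists M, forall k, dotp (u k) (u k) <= M.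
  exists (2 * Mv + 2 * ((P 0%N - mu) / kap)) => k.
  have -> : u k = v k + - (v k - u k) by rewrite opprB addrC subrK.
  apply: le_trans (dotp_add_le _ _) _.
  apply: lerD; rewrite ler_wpM2l //.
  rewrite dotpNl dotpNr opprK -/(D k) ler_pdivlMr // mulrC.
  have := decrease k; have := P_mu k.+1.
  have : P k <= P 0%N by exact: P_noninc.
  lra.
(* [s k = u k + gamma *: G (u k)], and [G] grows at most linearly from [G 0]. *)
have [Ms sM] : exists M, forall k, dotp (s k) (s k) <= M.
  exists (2 * Mu + 2 * (gamma ^+ 2 * (2 * (L ^+ 2 * Mu) + 2 * dotp (G 0) (G 0)))) => k.
  rewrite (prox1 _ _ (uk k)); apply: le_trans (dotp_add_le _ _) _.
  apply: lerD; rewrite ler_wpM2l // dotpZl dotpZr mulrA -expr2.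
  rewrite ler_wpM2l ?sqr_ge0 // -{1 2}(subrK (G 0) (G (u k))).
  apply: le_trans (dotp_add_le _ _) _; rewrite lerD2r ler_wpM2l //.
  apply: le_trans (lip _ _) _; rewrite subr0 ler_wpM2l ?sqr_ge0 //.

(* Monotone envelope, limit points, and stationarity for the original problem *)
split.
- split.
    by move=> i j ij; rewrite !PE lee_fin; exact: P_noninc.
  have := cvg_comp _ _ D_cvg (@sqrt_continuous R 0).
  by rewrite sqrtr0.
- split.
  + have [Ns sN] := bounded_range_of_dotp sM.
    have [Nu uN] := bounded_range_of_dotp uM.
    have [Nv vN] := bounded_range_of_dotp vM.
    exists (Num.max (Num.max Ns Nu) Nv); split=> [|N NN _ [k _ <-]].
      exact: num_real.
    apply: le_trans (ltW NN).
    by rewrite !prod_normE /= !ge_max !le_max sN uN vN !orbT.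
  + move=> ks sstar kinc s_cvg; have [x0 /proxX pu] := X_nonempty sstar.
    have pv := limit_fixed _ _ _ kinc s_cvg pu; set ustar := A *m x0 in pu pv *.
    split; first by exists ustar, ustar; split=> //; rewrite addrK.
    exists ustar; split; first exact: prox_set1.
    have phi1_gtNy w : (-oo < phi1 w)%E by rewrite ltNye_eq phi1_fin.
    move: pu pv; rewrite !proxE.
    move=> /(argmin_penalized_subdiff phi1_gtNy b0) ?.
    move=> /(argmin_penalized_subdiff phi2_gtNy b0) ?.
    do 2!eexists; split; [eassumption|eassumption|].
    (* The two subgradients are the same multiple of [ustar - sstar] and [sstar - ustar], so they
       cancel. *)
    rewrite trmx1 !mul1mx subr_reflection -scalerDr.
    by rewrite -[sstar - ustar]opprB subrr scaler0.
  + have [ks [sstar [kinc s_cvg]]] := bounded_subseq sM.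
    by exists ks, sstar.
- move=> B4 ks sstar ustar kinc s_cvg pstar.
  have pu : prox gamma phi1 sstar ustar by rewrite pstar.
  split.
    have [z0] := Z_nonempty 0; rewrite Z_subE.
    move=> /(argmin_penalizedP _ _ g_gtNy)[t0 gz0 _].
    have b20 : 0 <= beta / 2 by rewrite divr_ge0 // ltW.
    (* [Ma] bounds the squared norm of the centre [2 *: u k - s k - c], and [alpha] the subproblem
       objective at [z0], hence [g (z k)]. As [B *m z k + c = v k] is bounded, every [z k] lies in
       one level set of the objective centred at 0. *)
    pose Ma := 2 * (2 * (4 * Mu) + 2 * Ms) + 2 * dotp c c.
    pose alpha := t0 + beta / 2 * (2 * dotp (B *m z0) (B *m z0) + 2 * Ma).
    have [N [Nreal zN]] := (B4 0).1 (alpha + beta / 2 * Mv).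
    exists N; split=> // N' NN' _ [k _ <-]; apply: zN NN' _ _ => /=.
    have := run_z run (ks k); rewrite Z_subE.
    move=> /(argmin_penalizedP _ _ g_gtNy)[r gzk /(_ _ _ gz0) le_r].
    rewrite /Z_obj gzk subr0 -(run_v run) sqr_enorm -EFinD lee_fin.
    apply: lerD; last by rewrite ler_wpM2l.
    apply: le_trans (le_trans _ le_r) _; first by rewrite lerDl mulr_ge0 ?dotp_ge0.
    rewrite lerD2l ler_wpM2l //; apply: le_trans (dotp_add_le _ _) _.
    rewrite lerD2l ler_wpM2l // dotpNl dotpNr opprK.
    apply: le_trans (dotp_add_le _ _) _.
    apply: lerD; rewrite ler_wpM2l //; last by rewrite dotpNl dotpNr opprK.
    apply: le_trans (dotp_add_le _ _) _; apply: lerD; rewrite ler_wpM2l //.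
      by have := uM (ks k); rewrite !dotpE; lra.
    by rewrite dotpNl dotpNr opprK.
  move=> xstar ystar zstar /cluster_subseq[js [jinc z_cvg]] x_min ->.
  have kjinc : increasing_seq (ks \o js).
    by move=> i j; exact: etrans (kinc _ _) (jinc _ _).
  have s_cvg' : (s \o (ks \o js)) @ \oo --> sstar.
    exact: (cvg_subseq jinc s_cvg).
  have [u_cvg v_cvg] := limits _ _ _ kjinc s_cvg' pu.
  have Ax : A *m xstar = ustar by have := proxX _ _ x_min; rewrite pstar.
  have Bz : B *m zstar + c = ustar.
    have Bz_cvg : (v \o (ks \o js)) @ \oo --> B *m zstar + c.
      under eq_cvg do rewrite /= (run_v run).
      by apply: cvgD; [exact: cvg_mulmx|exact: cvg_cst].
    exact: (cvg_unique _ Bz_cvg v_cvg).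
  have z_min : argmin (penalized g B (beta / 2) (2 *: ustar - sstar - c)) zstar.
    apply: (argmin_penalized_closed g_gtNy g_lsc z_cvg
      (as_ := fun k => 2 *: u (ks (js k)) - s (ks (js k)) - c)) => [|k].
      apply: cvgB; last exact: cvg_cst.
      by apply: cvgB => //; exact: cvgZl_tmp.
    by rewrite -Z_subE; exact: (run_z run).
  have b20 : 0 <= beta / 2 by rewrite divr_ge0 // ltW.
  have b2E : 2 * (beta / 2) = beta by rewrite mulrC divfK.
  split.
  + by rewrite Ax -Bz addrAC subrr add0r.
  + by have := argmin_penalized_subdiff f_gtNy b20 x_min; rewrite b2E Ax.
  (* The residual [B *m zstar + c - (2 *: ustar - sstar)] equals [sstar - ustar], the opposite of
     [ystar]; this gives the positive sign. *)
  + have := argmin_penalized_subdiff g_gtNy b20 z_min; rewrite b2E.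
    rewrite opprB addrA Bz subr_reflection -(opprB ustar) mulmxN scalerN scaleNr.
    by rewrite opprK.
Qed.
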